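(* Let $d\ge 1$, let $M$ be a matroid of rank $d+1$ on a finite ground set $E$, and let $V : E \to \mathbb{T}_{\max}^d$ be a map. Assume that $0 \in \operatorname{tconv}(V(C \cup D))$ for any two distinct cocircuits $C, D$ of $M$, where $0=(0,\dots,0)\in\mathbb{R}^d$. Then there exists a basis $B_0$ of $M$ such that $0 \in \operatorname{tconv}(V(B_0))$.
   Context: The max-tropical semiring is $\mathbb{T}_{\max} = \mathbb{R}\cup\{-\infty\}$ with $a\oplus b=\max(a,b)$ and $a\odot b = a+b$; scalar multiplication and addition of vectors in $\mathbb{T}_{\max}^d$ are coordinatewise. For a finite set $W=\{v^1,\dots,v^n\}\subset\mathbb{T}_{\max}^d$, the tropical convex hull is $$\operatorname{tconv}(W)=\Big\{\bigoplus_{j=1}^n \lambda_j\odot v^j \;:\; \lambda_j\in\mathbb{T}_{\max},\ \bigoplus_{j}\lambda_j = 0\Big\}.$$ For $S\subseteq E$, $V(S)=\{V(e):e\in S\}$. Here $0\in\mathbb{T}_{\max}^d$ is the all-zeros (real) vector. A cocircuit of $M$ is a circuit of the dual matroid $M^*$, equivalently an inclusion-minimal subset of $E$ meeting every basis of $M$. *)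

(* Defs.v *)
From HB Require Import structures.
From mathcomp Require Import all_boot all_order all_algebra.
From mathcomp Require Import finmap.
From mathcomp Require Import reals.

Set Implicit Arguments.
Unset Strict Implicit.
Unset Printing Implicit Defensive.

Import Order.TTheory GRing.Theory Num.Theory.

Local Open Scope ring_scope.

#[local] Set Warnings "-redundant-canonical-projection".

(* The max-tropical semiring: [None] stands for -oo and [Some r] for the real
   number r.  As a MathComp semiring its [+] is the maximum and its [*] is the
   addition of reals, so its [0] is -oo and its [1] is the real number 0. *)
Definition tmax (R : realType) : Type := option R.

Definition tfin {R : realType} (r : R) : tmax R := Some r.

Section TropicalSemiring.
Variable R : realType.

Definition tadd (x y : tmax R) : tmax R :=
  match x, y with
  | Some a, Some b => Some (Order.max a b)
  | Some a, None => Some a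
  | None, _ => y
  end.

Definition tmul (x y : tmax R) : tmax R :=
  match x, y with
  | Some a, Some b => Some (a + b)
  | _, _ => None
  end.

Lemma taddA : associative tadd.
Proof. by case=> [a|] [b|] [c|] //=; rewrite maxA. Qed.

Lemma taddC : commutative tadd.
Proof. by case=> [a|] [b|] //=; rewrite maxC. Qed.

Lemma tadd0x : left_id None tadd.
Proof. by []. Qed.

Lemma tmulA : associative tmul.
Proof. by case=> [a|] [b|] [c|] //=; rewrite addrA. Qed.

Lemma tmulC : commutative tmul.
Proof. by case=> [a|] [b|] //=; rewrite addrC. Qed.

Lemma tmul1x : left_id (tfin 0) tmul.
Proof. by case=> [a|] //=; rewrite add0r. Qed.

Lemma tmulDl : left_distributive tmul tadd.
Proof. by case=> [a|] [b|] [c|] //=; rewrite addr_maxl. Qed.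

Lemma tmul0x : left_zero None tmul.
Proof. by []. Qed.

HB.instance Definition _ := Choice.copy (tmax R) (option R).
HB.instance Definition _ := GRing.isNmodule.Build (tmax R) taddA taddC tadd0x.
HB.instance Definition _ := GRing.Nmodule_isComNzSemiRing.Build (tmax R)
  tmulA tmulC tmul1x tmulDl tmul0x isT.

End TropicalSemiring.

(* [\sum], [+] and [*:] are those of the tropical semiring [tmax R]. *)
Definition tconv (R : realType) (d : nat) (W : {fset 'rV[tmax R]_d})
    (x : 'rV[tmax R]_d) : Prop :=
  exists lambda : 'rV[tmax R]_d -> tmax R,
    \sum_(v <- W) lambda v = tfin 0 /\ x = \sum_(v <- W) lambda v *: v.

(* The real vector (0, ..., 0), as opposed to [0 : 'rV[tmax R]_d], all of whose
   entries are -oo. *)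
Definition tvec0 (R : realType) (d : nat) : 'rV[tmax R]_d := const_mx (tfin 0).

Record matroid (E : finType) := Matroid {
  indep : {set {set E}};
  indep0 : set0 \in indep;
  indepS : forall I J : {set E}, I \subset J -> J \in indep -> I \in indep;
  indep_aug : forall I J : {set E}, I \in indep -> J \in indep ->
    (#|I| < #|J|)%N -> exists2 x, x \in J :\: I & x |: I \in indep }.

Section Matroid.
Variables (E : finType) (M : matroid E).

Definition basis (B : {set E}) : bool := maxset (mem (indep M)) B.

Definition circuit (C : {set E}) : bool :=
  minset (fun A : {set E} => A \notin indep M) C.

Definition rank : nat := \max_(I in indep M) #|I|.

Lemma basis_indep B : basis B -> B \in indep M.
Proof. by move/maxsetp. Qed.

Lemma basis_card I B : I \in indep M -> basis B -> (#|I| <= #|B|)%N.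
Proof.
move=> iI bB; rewrite leqNgt; apply/negP=> ltBI.
have [x] := indep_aug (basis_indep bB) iI ltBI.
rewrite inE => /andP[xB _] ixB; move/negP: xB; apply.
by rewrite -(maxsetsup bB ixB (subsetUr _ _)) setU11.
Qed.

Lemma basis_exists : exists B, basis B.
Proof.
have [B bB _] := maxset_exists (P := mem (indep M)) (indep0 M).
by exists B.
Qed.

Lemma indep_extend I B : I \in indep M -> basis B ->
  exists B', [/\ basis B', I \subset B' & B' \subset I :|: B].
Proof.
move=> iI bB.
pose P (J : {set E}) := (J \in indep M) && (J \subset I :|: B).
have PI : P I by rewrite /P iI subsetUl.
have [B' mB' sIB'] := maxset_exists PI.
have /andP[iB' sB'] := maxsetp mB'.
have leBB' : (#|B| <= #|B'|)%N.
  rewrite leqNgt; apply/negP=> lt.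
  have [x] := indep_aug iB' (basis_indep bB) lt.
  rewrite inE => /andP[xB' xB] ixB'; move/negP: xB'; apply.
  have PxB' : P (x |: B') by rewrite /P ixB' subUset sB' sub1set inE xB orbT.
  by rewrite -(maxsetsup mB' PxB' (subsetUr _ _)) setU11.
exists B'; split=> //; apply/maxsetP; split=> // J iJ sB'J.
by apply/esym/eqP; rewrite eqEcard sB'J (leq_trans (basis_card iJ bB)).
Qed.

Definition dual_indep : {set {set E}} :=
  [set I : {set E} | [exists B, basis B && [disjoint I & B]]].

Lemma dual_indepP (I : {set E}) :
  reflect (exists2 B, basis B & [disjoint I & B]) (I \in dual_indep).
Proof.
rewrite inE; apply: (iffP existsP) => [[B /andP[? ?]]|[B ? ?]].
  by exists B.
by exists B; apply/andP.
Qed.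

Lemma dual_indep0 : set0 \in dual_indep.
Proof.
have [B bB] := basis_exists; apply/dual_indepP; exists B => //.
by rewrite -setI_eq0 set0I.
Qed.

Lemma dual_indepS (I J : {set E}) :
  I \subset J -> J \in dual_indep -> I \in dual_indep.
Proof.
move=> sIJ /dual_indepP[B bB dJB]; apply/dual_indepP; exists B => //.
exact: disjointWl sIJ dJB.
Qed.

Lemma dual_indep_aug (I J : {set E}) : I \in dual_indep -> J \in dual_indep ->
  (#|I| < #|J|)%N -> exists2 x, x \in J :\: I & x |: I \in dual_indep.
Proof.
move=> /dual_indepP[B bB dIB] /dual_indepP[B1 bB1 dJB1] ltIJ.
have iB1I : B1 :\: I \in indep M.
  exact: indepS (subsetDl _ _) (basis_indep bB1).
have [B' [bB' sB1 sB']] := indep_extend iB1I bB.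
have dIB' : [disjoint I & B'].
  apply: disjointWr sB' _; rewrite -setI_eq0 setIUr.
  by rewrite setIDA setIC -setIDA setDv setI0 set0U setI_eq0.
have [sJB'|/subsetPn[x xJI xB']] := boolP (J :\: I \subset B').
  have dd : [disjoint B1 :\: I & J :\: I].
    apply: disjointWl (subsetDl _ _) _; apply: disjointWr (subsetDl _ _) _.
    by rewrite disjoint_sym.
  have le1 : (#|(B1 :\: I) :|: (J :\: I)| <= #|B1|)%N.
    apply: leq_trans (basis_card (basis_indep bB') bB1).
    by apply: subset_leq_card; rewrite subUset sB1.
  have le2 : (#|B1 :&: I| <= #|I :\: J|)%N.
    apply: subset_leq_card; apply/subsetP=> y; rewrite !inE => /andP[yB1 ->].
    by rewrite andbT; apply: contraTN yB1 => yJ; rewrite (disjointFr dJB1 yJ).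
  move: le1; rewrite cardsU (disjoint_setI0 dd) cards0 subn0.
  rewrite -(cardsID I B1) addnC leq_add2r => le1.
  have := leq_trans le1 le2; rewrite leqNgt => /negP[].
  by rewrite -(ltn_add2l #|I :&: J|) cardsID {1}setIC cardsID.
exists x => //; apply/dual_indepP; exists B' => //.
by rewrite -setI_eq0 setIUl (disjoint_setI0 dIB') setU0 setI_eq0 disjoints1.
Qed.

Definition dual : matroid E :=
  Matroid dual_indep0 dual_indepS dual_indep_aug.

End Matroid.

Definition cocircuit (E : finType) (M : matroid E) (C : {set E}) : bool :=
  circuit (dual M) C.

Lemma cocircuitE (E : finType) (M : matroid E) (C : {set E}) :
  cocircuit M C =
  minset (fun A : {set E} => [forall B, basis M B ==> (A :&: B != set0)]) C.
Proof.
apply: minset_eq => A; rewrite inE negb_exists; apply: eq_forallb => B.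
by rewrite negb_and implybE setI_eq0.
Qed.

(* Main.v *)
Require Import Defs.
From mathcomp Require Import all_boot all_order all_algebra.
From mathcomp Require Import finmap.
From mathcomp Require Import reals.
From mathcomp Require Import zify.

(* Homogenize a vector [v] by a coordinate equal to the real number 0, and let
   [tsupp v] be the set of the d+1 coordinates at which [v] attains its maximum.
   By residuation, 0 lies in tconv(W) iff the sets [tsupp v], v in W, cover the d+1
   coordinates.  Hence, with X_i the set of elements e of the ground set such
   that i is in [tsupp (V e)], we seek an independent set meeting every X_i.  The
   hypothesis says that no X_i avoids two distinct cocircuits, which forces X_i
   to have rank at least d; and the X_i cover the ground set.  Those are Rado's
   conditions for an independent transversal, here obtained greedily: complete
   d independent elements of X_b by some e to a basis, with e in X_a say; start
   from e, pick an element in each X_i other than X_a and X_b, and finally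
   augment from the basis, which can only add an element of X_b. *)

Import Order.TTheory GRing.Theory Num.Theory.

Section TropicalHull.
Set Implicit Arguments.
Unset Strict Implicit.
Local Open Scope ring_scope.
Context {R : realType}.

Lemma taddxx : idempotent_op (@GRing.add (tmax R)).
Proof. by case=> [a|] //; rewrite /GRing.add /= maxxx. Qed.

Lemma tadd_sel (x y : tmax R) : x + y = x \/ x + y = y.
Proof.
case: x y => [a|] [b|]; rewrite /GRing.add /=; try by [left|right].
by case: (leP a b) => _; [right|left].
Qed.

(* In the idempotent semiring [tmax R], [x + y = y] means that x <= y. *)
Lemma tsum_ub (I : eqType) (s : seq I) (F : I -> tmax R) (i : I) :
  i \in s -> F i + \sum_(j <- s) F j = \sum_(j <- s) F j.
Proof. by move=> i_s; rewrite (big_rem i) //= addrA taddxx. Qed.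

Lemma tsum_attained (I : eqType) (s : seq I) (F : I -> tmax R) :
  \sum_(i <- s) F i != 0 -> exists2 i, i \in s & F i = \sum_(i <- s) F i.
Proof.
elim: s => [|j s IHs]; first by rewrite big_nil eqxx.
rewrite big_cons; case: (tadd_sel (F j) (\sum_(i <- s) F i)) => -> nz.
  by exists j; rewrite ?mem_head.
by have [i i_s Fi] := IHs nz; exists i; rewrite // inE i_s orbT.
Qed.

Lemma tsum_eq (I : eqType) (s : seq I) (F : I -> tmax R) (c : tmax R) (i : I) :
  (forall j, j \in s -> F j + c = c) -> i \in s -> F i = c ->
  \sum_(j <- s) F j = c.
Proof.
move=> le_c i_s Fi; rewrite -(tsum_ub F i_s) Fi addrC.
elim: s le_c {i_s} => [|j s IHs] le_c; first by rewrite big_nil add0r.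
rewrite big_cons -addrA IHs => [|k k_s]; first by rewrite le_c ?mem_head.
by rewrite le_c // inE k_s orbT.
Qed.

Definition tcoord d (v : 'rV[tmax R]_d) (i : option 'I_d) : tmax R :=
  if i is Some j then v 0 j else 1.

Definition tnorm d (v : 'rV[tmax R]_d) : tmax R := \sum_i tcoord v i.

Definition tsupp d (v : 'rV[tmax R]_d) : {set option 'I_d} :=
  [set i | tcoord v i == tnorm v].

(** The coordinate at [None] is real, so the maximum is not -oo. *)
Lemma tnorm_neq0 d (v : 'rV[tmax R]_d) : tnorm v != 0.
Proof.
apply/eqP=> v0.
have := tsum_ub (tcoord v) (mem_index_enum None).
by rewrite -/(tnorm v) v0.
Qed.

Lemma tsupp_neq0 d (v : 'rV[tmax R]_d) : exists i, i \in tsupp v.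
Proof.
by have [i _ vi] := tsum_attained (tnorm_neq0 v); exists i; rewrite inE; apply/eqP.
Qed.

Definition tinv (x : tmax R) : tmax R := omap -%R x.

Lemma tmulVx (x : tmax R) : x != 0 -> tinv x * x = 1.
Proof. by case: x => [a|] // _; rewrite /GRing.mul /= addNr. Qed.

Lemma tmulVl_inj (c x y : tmax R) : c * x = 1 -> c * y = 1 -> x = y.
Proof. by move=> cx cy; rewrite -[x]mul1r -cy mulrAC cx mul1r. Qed.

(** The coefficient of [v] can be at most minus [tnorm v], or some coordinate of the sum would
    exceed the real number 0; with equality, the summand of [v] reaches 0 exactly on [tsupp v]. *)
Lemma tconv0P d (W : {fset 'rV[tmax R]_d}) :
  tconv W (tvec0 R d) <-> forall i, exists2 v, v \in W & i \in tsupp v.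
Proof.
(* At [None] the equation is the normalization of [lambda], so one family of equations holds both
   conditions. *)
have tcoord_sum (lambda : 'rV[tmax R]_d -> tmax R) :
    (\sum_(v <- W) lambda v = tfin 0 /\ tvec0 R d = \sum_(v <- W) lambda v *: v)
    <-> forall i, \sum_(v <- W) lambda v * tcoord v i = 1.
  split=> [[l1 l0] [j|]|l1].
  - have /rowP/(_ j) := l0; rewrite summxE mxE => l0j.
    by apply: etrans (esym l0j); apply: eq_bigr => v _; rewrite mxE.
  - by apply: etrans l1; apply: eq_bigr => v _; rewrite mulr1.
  split.
    by apply: etrans (l1 None); apply: eq_bigr => v _; rewrite mulr1.
  apply/rowP=> j; rewrite summxE mxE; apply: etrans (esym (l1 (Some j))) _.
  by apply: eq_bigr => v _; rewrite mxE.
split=> [[lambda /tcoord_sum l1] i|cov].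
  have [|v vW lv] := @tsum_attained _ W (fun v => lambda v * tcoord v i).
    by rewrite l1.
  rewrite l1 in lv; exists v; rewrite // inE; apply/eqP.
  (* Also [lambda v * tnorm v] is [1]: each [lambda v * tcoord v k] is at most [1], with equality at
     [k = i]. *)
  apply: (tmulVl_inj lv); rewrite mulr_sumr.
  apply: (tsum_eq _ (mem_index_enum i)) => // k _.
  by rewrite -(l1 k); apply: (tsum_ub (fun v => lambda v * tcoord v k)).
exists (fun v => tinv (tnorm v)); apply/tcoord_sum => i.
have [v vW] := cov i; rewrite inE => /eqP vi.
apply: (tsum_eq _ vW) => [w _|]; last by rewrite vi tmulVx // tnorm_neq0.
rewrite -(tmulVx (tnorm_neq0 w)) -mulrDr; congr (_ * _).
exact: (tsum_ub (tcoord w) (mem_index_enum i)).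
Qed.

Lemma tconv0_imfsetP d (E : finType) (V : E -> 'rV[tmax R]_d) (S : {set E}) :
  tconv [fset V e | e in S]%fset (tvec0 R d) <->
  forall i, exists2 e, e \in S & i \in tsupp (V e).
Proof.
split=> [/tconv0P cov i|cov].
  by have [_ /imfsetP[e eS ->] ie] := cov i; exists e.
apply/tconv0P => i; have [e eS ie] := cov i.
by exists (V e) => //; apply/imfsetP; exists e.
Qed.

End TropicalHull.

Section Matroids.
Set Implicit Arguments.
Unset Strict Implicit.
Variables (E : finType) (M : matroid E).

Lemma card_basis B : basis M B -> #|B| = rank M.
Proof.
move=> bB; apply/eqP; rewrite eqn_leq; apply/andP; split.
  by apply: (bigop.bigmax_sup B) => //; apply: basis_indep.
by apply/bigop.bigmax_leqP => I iI; apply: (basis_card iI bB).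
Qed.

Lemma basis_of_indep I : I \in indep M -> exists2 B, basis M B & I \subset B.
Proof.
move=> iI; have [B bB] := basis_exists M.
by have [B' [bB' sIB' _]] := indep_extend iI bB; exists B'.
Qed.

(* The condition on [z] says that [z] is outside the hyperplane spanned by
   [B :\ x], so that [C] is in fact the whole complement of that hyperplane. *)
Lemma cocircuit_sub B x : basis M B -> x \in B ->
  exists2 C, cocircuit M C &
    x \in C /\ forall z, z \in C -> z \notin B :\ x /\ z |: B :\ x \in indep M.
Proof.
move=> bB xB; pose A := [set z | (z \notin B :\ x) && (z |: B :\ x \in indep M)].
have iBx : B :\ x \in indep M by apply: indepS (basis_indep bB); apply: subsetDl.
pose meets (S : {set E}) := [forall B', basis M B' ==> (S :&: B' != set0)].
have meetsA : meets A.
  apply/forall_inP => B' bB'.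
  have [|z] := indep_aug iBx (basis_indep bB').
    by rewrite (card_basis bB') -(card_basis bB) (cardsD1 x B) xB.
  rewrite !in_setD => /andP[zBx zB'] iz.
  by apply/set0Pn; exists z; rewrite in_setI zB' andbT inE iz in_setD zBx.
have [C mC sCA] := minset_exists meetsA.
have CA z : z \in C -> z \notin B :\ x /\ z |: B :\ x \in indep M.
  by move/(subsetP sCA); rewrite inE => /andP.
exists C; first by rewrite cocircuitE.
(* [C] meets [B] but not [B :\ x], hence contains [x]. *)
split=> //; have /forall_inP/(_ B bB)/set0Pn[z] := minsetp mC.
rewrite in_setI => /andP[zC zB]; have [] := CA z zC.
by rewrite in_setD1 zB andbT negbK => /eqP <-.
Qed.

(** Let [I] be maximal independent in [X]. If it had fewer than [r] elements, a basis [B] containing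
    it would have two further elements [x] and [y]. The hyperplanes spanned by [B :\ x] and [B :\ y]
    both contain [X], and their complements contain distinct cocircuits, which avoid [X]. *)
Lemma indep_of_cocircuits (X : {set E}) r : (r < rank M)%N ->
  (forall C D, cocircuit M C -> cocircuit M D -> C <> D ->
     exists2 e, e \in C :|: D & e \in X) ->
  exists I, [/\ I \in indep M, I \subset X & r <= #|I|]%N.
Proof.
move=> ltr meetX.
have [I /maxsetP[/andP[iI sIX] maxI] _] :=
  @maxset_exists _ (fun I => (I \in indep M) && (I \subset X)) set0
    (introT andP (conj (indep0 M) (sub0set X))).
exists I; split=> //; rewrite leqNgt; apply/negP => ltI.
have [B bB sIB] := basis_of_indep iI.
have : (1 < #|B :\: I|)%N.
  have := cardsID I B; rewrite (card_basis bB) (setIidPr sIB).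
  by move: #|I| #|B :\: I| ltI ltr => [|m] [|[|n]]; lia.
case/card_gt1P => x [y [xBI yBI xy]].
have avoidX u (C : {set E}) : u \in B :\: I ->
    (forall z, z \in C -> z \notin B :\ u /\ z |: B :\ u \in indep M) ->
    forall z, z \in C -> z \notin X.
  rewrite in_setD => /andP[uI uB] CB z /CB[zBu iz]; apply/negP => zX.
  have sIBu : I \subset B :\ u by rewrite subsetD1 sIB uI.
  move/negP: zBu; apply; apply: (subsetP sIBu).
  rewrite -(maxI (z |: I)) ?setU11 ?subsetUr //.
  by rewrite (indepS (setUS _ sIBu) iz) subUset sub1set zX.
have xB : x \in B by case/setDP: xBI.
have yB : y \in B by case/setDP: yBI.
have [C cC [xC CB]] := cocircuit_sub bB xB.
have [D cD [_ DB]] := cocircuit_sub bB yB.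
have neCD : C <> D.
  move=> eqCD; have [] := DB x; first by rewrite -eqCD.
  by rewrite in_setD1 xy xB.
have [e /setUP[eC|eD] eX] := meetX C D cC cD neCD.
  by have := avoidX x C xBI CB e eC; rewrite eX.
by have := avoidX y D yBI DB e eD; rewrite eX.
Qed.

(** While the current set has fewer than [r] elements, augmenting it from an independent part of
    [X i] supplies an element of [X i]; the size bound leaves room for one step per index. *)
Lemma indep_greedy (T : eqType) (X : T -> {set E}) r (s : seq T) I0 :
  (forall i, exists I, [/\ I \in indep M, I \subset X i & r <= #|I|]%N) ->
  I0 \in indep M -> (#|I0| + size s <= r)%N ->
  exists I, [/\ I \in indep M, I0 \subset I, #|I| <= r
    & forall i, i \in s -> exists2 e, e \in I & e \in X i]%N.
Proof.
move=> rkX; elim: s I0 => [|i s IHs] I0 iI0; rewrite ?addn0 ?addnS /= => le_r.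
  by exists I0; split.
have [J [iJ sJX leJ]] := rkX i.
have [|x /setDP[xJ xI0] ix] := indep_aug iI0 iJ.
  by apply: leq_trans leJ; apply: leq_trans le_r; rewrite ltnS leq_addr.
have [|I [iI sI leI XI]] := IHs _ ix; first by rewrite cardsU1 xI0.
exists I; split=> // [|j]; first by apply: subset_trans sI; apply: subsetUr.
rewrite inE => /predU1P[->|/XI //].
by exists x; [apply: (subsetP sI); rewrite setU11 | apply: (subsetP sJX)].
Qed.

Lemma basis_transversal (T : finType) (X : T -> {set E}) r :
  #|T| = r.+1 -> rank M = r.+1 ->
  (forall i, exists I, [/\ I \in indep M, I \subset X i & r <= #|I|]%N) ->
  (forall e, exists i, e \in X i) ->
  exists2 B, basis M B & forall i, exists2 e, e \in B & e \in X i.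
Proof.
move=> cardT rkM rkX covX.
have [b _] : exists b : T, b \in T by apply/card_gt0P; rewrite cardT.
have [J [iJ sJX leJ]] := rkX b.
have [K bK sJK] := basis_of_indep iJ.
have cardK : #|K| = r.+1 by rewrite (card_basis bK).
(* At most one element of [K] lies outside [J], which has at least [r] elements; if there is none,
   any [e] in [K] will do. *)
have [e [eK KeX]] : exists e, e \in K /\ forall x, x \in K -> x != e -> x \in X b.
  have [sKJ|/subsetPn[e eK eJ]] := boolP (K \subset J).
    have /card_gt0P[e eK] : (0 < #|K|)%N by rewrite cardK.
    by exists e; split=> // x /(subsetP sKJ)/(subsetP sJX).
  exists e; split=> // x xK xe; apply: (subsetP sJX); apply/negPn/negP => xJ.
  have : (#|x |: (e |: J)| <= #|K|)%N.
    by apply: subset_leq_card; rewrite !subUset !sub1set xK eK.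
  by rewrite !cardsU1 in_setU1 negb_or xe xJ eJ cardK !add1n !ltnS leqNgt ltnS leJ.
have [a eXa] := covX e.
(* If [a = b], the last element added will serve this index, and starting from [e] would exceed the
   allowed size [r]. *)
pose I0 := if a == b then set0 else [set e].
have iI0 : I0 \in indep M.
  by apply: indepS (basis_indep bK); rewrite /I0; case: ifP; rewrite ?sub0set ?sub1set.
have le_r : (#|I0| + size (enum (~: [set a; b])) <= r)%N.
  rewrite -cardE /I0; have := cardsC [set a; b]; rewrite cards2 cardT.
  by case: (a == b); rewrite ?cards0 ?cards1; lia.
have [I [iI sI leI XI]] := indep_greedy rkX iI0 le_r.
(* This [x] is in [X b]: either [e] is already in [I] and [x] differs from it, or [a = b] and [e] is
   in [X b] as well. *)
have [|x /setDP[xK xI] ix] := indep_aug iI (basis_indep bK).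
  by rewrite cardK ltnS.
have [B bB sB] := basis_of_indep ix.
exists B => // i; have [->|ib] := eqVneq i b.
  exists x; first by apply: (subsetP sB); rewrite setU11.
  have [xe|/(KeX x xK) //] := eqVneq x e.
  move: xI; rewrite xe; have [<- //|ab] := eqVneq a b.
  by move/negP; case; apply: (subsetP sI); rewrite /I0 (negPf ab) set11.
have [ia|ia] := eqVneq i a.
  exists e; last by rewrite ia.
  apply: (subsetP sB); apply/setU1P; right; apply: (subsetP sI).
  by rewrite /I0 -ia (negPf ib) set11.
have [|u uI uX] := XI i; first by rewrite mem_enum !inE negb_or ia ib.
by exists u; rewrite // (subsetP sB) // setU1r.
Qed.

End Matroids.

Theorem theorem2p11 (R : realType) (d : nat) (hd : (1 <= d)%N)
  (E : finType) (M : matroid E) (hM : rank M = d.+1)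
  (V : E -> 'rV[tmax R]_d)
  (hV : forall C D : {set E}, cocircuit M C -> cocircuit M D -> C <> D ->
    tconv [fset V e | e in C :|: D]%fset (tvec0 R d)) :
  exists B0 : {set E},
    basis M B0 /\ tconv [fset V e | e in B0]%fset (tvec0 R d).
Proof.
pose X i := [set e | i \in tsupp (V e)].
have [|i||B bB cov] := @basis_transversal E M (option 'I_d) X d _ hM.
- by rewrite card_option card_ord.
- apply: indep_of_cocircuits => [|C D cC cD neCD]; first by rewrite hM.
  have [e eCD ie] := (tconv0_imfsetP _ _).1 (hV C D cC cD neCD) i.
  by exists e => //; rewrite inE.
- by move=> e; have [i ie] := tsupp_neq0 (V e); exists i; rewrite inE.
exists B; split=> //; apply/tconv0_imfsetP => i.
by have [e eB] := cov i; rewrite inE; exists e.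
Qed.
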